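(* Let $V$ be a finite-dimensional real $\mathbb{Z}$-graded vector space with a degree $\ell$ metric $g$. Then: (i) there is a direct sum decomposition $\mathfrak{gl}(V)=\mathrm{Sym}(V,g)\oplus\mathfrak{o}(V,g)$ of graded vector spaces; (ii) $\mathfrak{o}(V,g)$ is a graded Lie subalgebra of $(\mathfrak{gl}(V),[\cdot,\cdot])$; (iii) the projector $p:\mathfrak{gl}(V)\to\mathfrak{gl}(V)$ onto the subspace $\mathfrak{o}(V,g)$ (with respect to the decomposition in (i)) is $p=\frac12(\mathbb{1}_{\mathfrak{gl}(V)}-\tau)$, where $\tau(A)=(-1)^{\ell|A|}g^{-1}A^Tg$.
   Context: A graded vector space is a sequence $V=(V_j)_{j\in\mathbb{Z}}$ of real vector spaces with $\sum_j\dim V_j<\infty$. $\mathfrak{gl}(V)$ is the graded vector space of linear maps $A:V\to V$ of arbitrary degree ($A$ of degree $|A|$ maps $V_j$ to $V_{j+|A|}$), with graded commutator $[A,B]=AB-(-1)^{|A||B|}BA$. $V^*$ is the graded dual, $(V^* )_j=(V_{-j})^*$. For $A\in\mathfrak{gl}(V)$ the transpose $A^T\in\mathfrak{gl}(V^* )$ is $[A^T(\xi)](v)=(-1)^{|A||\xi|}\xi(A(v))$. A degree $\ell$ metric on $V$ is a bilinear map $g:V\times V\to\mathbb{R}$ with $g(v,w)=0$ unless $|v|+|w|+\ell=0$, $g(v,w)=(-1)^{(|v|+\ell)(|w|+\ell)}g(w,v)$, and such that the degree $\ell$ linear map $g:V\to V^*$ (denoted by the same symbol), $[g(v)](w):=(-1)^{(|v|+1)\ell}g(v,w)$,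 is an isomorphism; $g^{-1}:V^*\to V$ is its inverse. $A\in\mathfrak{gl}(V)$ is symmetric with respect to $g$ if $gA=(-1)^{\ell|A|}A^Tg$, and skew-symmetric with respect to $g$ if $gA=-(-1)^{\ell|A|}A^Tg$; the graded subspaces of such maps are $\mathrm{Sym}(V,g)$ and $\mathfrak{o}(V,g)$. *)

(* Defs.v *)
From HB Require Import structures.
From mathcomp Require Import all_boot all_order all_algebra.
From mathcomp Require Import sesquilinear.
From mathcomp Require Import finmap.
From mathcomp Require Import boolp classical_sets functions cardinality fsbigop.
From mathcomp Require Import reals constructive_ereal ereal esum.

Set Implicit Arguments.
Unset Strict Implicit.
Unset Printing Implicit Defensive.

Import Order.TTheory GRing.Theory Num.Theory.

Local Open Scope classical_set_scope.
Local Open Scope ring_scope.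

(* [V : gradedVect R] is the sequence of its components [V j]; its elements
   are the homogeneous ones, and the degree is read off the type. *)
Record gradedVect (R : realType) := GradedVect {
  gcomponent :> int -> vectType R;
  gdim_finite :
    (\esum_(j in [set: int]) (\dim {: gcomponent j})%:R%:E < +oo :> \bar R)%E }.

Lemma esum_dim_finite (R : realType) (V : int -> vectType R) :
  (\esum_(j in [set: int]) (\dim {: V j})%:R%:E < +oo :> \bar R)%E <->
  finite_set [set j | \dim {: V j} != 0%N].
Proof.
split=> [fin|fin].
  apply: contrapT => /infinite_set_fset inf.
  set e := esum _ _ in fin.
  have e_ge n : ((n%:R : R)%:E <= e)%E.
    have [B Bsub Bn] := inf n.
    apply: esum_ge; exists [set` B]; first by split; [exact: finite_fset|].
    rewrite fsbig_finite ?finite_fset //= set_fsetK.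
    apply: (@le_trans _ _ (\sum_(i <- enum_fset B) (1%:R : R)%:E)%E).
      by rewrite sumEFin lee_fin -natr_sum sum1_size ler_nat.
    rewrite big_seq_cond [leRHS]big_seq_cond; apply: lee_sum => i.
    rewrite andbT => iB; rewrite lee_fin ler_nat lt0n; exact: Bsub.
  have e0 : (0 <= e)%E by exact: (e_ge 0%N).
  have efin : e \is a fin_num by rewrite ge0_fin_numE.
  have := e_ge (Num.bound (fine e)).
  rewrite -(fineK efin) lee_fin leNgt.
  by rewrite archi_boundP // fine_ge0.
rewrite (_ : esum _ _ = esum [set j | \dim {: V j} != 0%N]
   (fun j => (\dim {: V j})%:R%:E)); last first.
  rewrite [RHS]esum_mkcond; apply: eq_esum => i _.
  case: ifPn => //; rewrite notin_setE /= => /negP; rewrite negbK => /eqP ->.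
  by [].
rewrite esum_fset //.
by rewrite fsbig_finite //= sumEFin ltry.
Qed.

Section GradedMaps.
Variable R : realType.
Implicit Types U V W : gradedVect R.

Definition gcast V i j (e : i = j) : 'Hom(V i, V j) :=
  match e with erefl => \1%VF end.

Lemma gcast_id V i (e : i = i) : gcast V e = \1%VF.
Proof. by rewrite (eq_irrelevance e erefl). Qed.

Lemma gcast_comp V i j k (e : i = j) (f : j = k) :
  (gcast V f \o gcast V e)%VF = gcast V (etrans e f).
Proof. by case: _ / f; rewrite comp_lfun1l. Qed.

Definition gsupport V : seq int :=
  enum_fset (fset_set [set j | \dim {: V j} != 0%N]).

Lemma mem_gsupport V j : (j \in gsupport V) = (\dim {: V j} != 0%N).
Proof.
have fin := (esum_dim_finite V).1 (gdim_finite V).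
by rewrite /gsupport in_fset_set // -[RHS]asboolb; apply/idP/idP; rewrite inE.
Qed.

Lemma gsupport_uniq V : uniq (gsupport V).
Proof. exact: fset_uniq. Qed.

Definition grHom V W (k : int) := forall j : int, 'Hom(V j, W (j + k)).

Section GrHomVect.
Import VectorInternalTheory.
Variables (V W : gradedVect R) (k : int).
Local Notation hom := (grHom V W k).
Implicit Types A B C : hom.

Lemma grHomP A B : (forall j, A j = B j) -> A = B.
Proof. exact: functional_extensionality_dep. Qed.

HB.instance Definition _ := gen_eqMixin hom.
HB.instance Definition _ := gen_choiceMixin hom.

Definition grHom_zero : hom := fun=> 0.
Definition grHom_opp A : hom := fun j => - A j.
Definition grHom_add A B : hom := fun j => A j + B j.
Definition grHom_scale (a : R) A : hom := fun j => a *: A j.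

Fact grHom_addA : associative grHom_add.
Proof. by move=> A B C; apply: grHomP => j; apply: addrA. Qed.
Fact grHom_addC : commutative grHom_add.
Proof. by move=> A B; apply: grHomP => j; apply: addrC. Qed.
Fact grHom_add0 : left_id grHom_zero grHom_add.
Proof. by move=> A; apply: grHomP => j; apply: add0r. Qed.
Fact grHom_addN : left_inverse grHom_zero grHom_opp grHom_add.
Proof. by move=> A; apply: grHomP => j; apply: addNr. Qed.
HB.instance Definition _ := GRing.isZmodule.Build hom
  grHom_addA grHom_addC grHom_add0 grHom_addN.

Fact grHom_scaleA a b A :
  grHom_scale a (grHom_scale b A) = grHom_scale (a * b) A.
Proof. by apply: grHomP => j; apply: scalerA. Qed.
Fact grHom_scale1 : left_id 1 grHom_scale.
Proof. by move=> A; apply: grHomP => j; apply: scale1r. Qed.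
Fact grHom_scaleDr : right_distributive grHom_scale +%R.
Proof. by move=> a A B; apply: grHomP => j; apply: scalerDr. Qed.
Fact grHom_scaleDl A : {morph grHom_scale^~ A : a b / a + b}.
Proof. by move=> a b; apply: grHomP => j; apply: scalerDl. Qed.
HB.instance Definition _ := GRing.Zmodule_isLmodule.Build R hom
  grHom_scaleA grHom_scale1 grHom_scaleDr grHom_scaleDl.

Lemma grHom_addE A B j : (A + B) j = A j + B j. Proof. by []. Qed.
Lemma grHom_oppE A j : (- A) j = - A j. Proof. by []. Qed.
Lemma grHom_scaleE a A j : (a *: A) j = a *: A j. Proof. by []. Qed.

Local Notation s := (gsupport V).
Local Notation m := (size s).
Local Notation homi i := 'Hom(V s`_i, W (s`_i + k)).

Definition grHom_v2r A : 'rV[R]_(\sum_(i < m) dim (homi i)) :=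
  \mxrow_(i < m) v2r (A s`_i).

Definition grHom_r2v (r : 'rV[R]_(\sum_(i < m) dim (homi i))) : hom := fun j =>
  \sum_(i < m)
    match s`_i =P j with
    | ReflectT e =>
        ecast j 'Hom(V j, W (j + k)) e (r2v (submxrow r i))
    | ReflectF _ => 0
    end.

Lemma grHom_r2v_nth r (i : 'I_m) :
  grHom_r2v r s`_i = r2v (submxrow r i).
Proof.
rewrite /grHom_r2v (bigD1 i) //= big1 ?addr0.
  by case: eqP => // e; rewrite (eq_irrelevance e erefl).
move=> i' ne; case: eqP => // e; case/eqP: ne; apply: val_inj => /=.
by apply/eqP; rewrite -(nth_uniq 0 (ltn_ord i') (ltn_ord i) (gsupport_uniq V))
  e.
Qed.

Lemma grHom_out A j : j \notin s -> A j = 0.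
Proof.
rewrite mem_gsupport negbK => /eqP d0; apply/lfunP => v.
have /eqP : v \in fullv := memvf v.
have := memvf v; rewrite (_ : fullv = 0%VS); last first.
  by apply/eqP; rewrite -dimv_eq0 d0.
by rewrite memv0 => /eqP ->; rewrite !linear0.
Qed.

Fact grHom_vect_iso : Vector.axiom (\sum_(i < m) dim (homi i)) hom.
Proof.
exists grHom_v2r.
  move=> a A B; apply/mxrowP => i; rewrite submxrowD.
  rewrite (_ : submxrow (a *: _) i = a *: submxrow (grHom_v2r A) i); last first.
    by apply/matrixP => ? ?; rewrite !mxE.
  by rewrite !mxrowK -linearP.
exists grHom_r2v => [A|r]; last first.
  by apply/mxrowP => i; rewrite mxrowK grHom_r2v_nth r2vK.
apply: grHomP => j; have [js|js] := boolP (j \in s); last first.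
  by rewrite (grHom_out A js) (grHom_out _ js).
have ltj : (index j s < m)%N by rewrite index_mem.
rewrite -(nth_index 0 js) -[index j s]/(val (Ordinal ltj)) grHom_r2v_nth.
by rewrite mxrowK v2rK.
Qed.
HB.instance Definition _ := Lmodule_hasFinDim.Build R hom grHom_vect_iso.

End GrHomVect.

Lemma esum_dim_seq (X : int -> vectType R) (s : seq int) :
  (forall j, j \notin s -> \dim {: X j} = 0%N) ->
  (\esum_(j in [set: int]) (\dim {: X j})%:R%:E < +oo :> \bar R)%E.
Proof.
move=> Xs; apply/esum_dim_finite.
apply: (@sub_finite_set _ _ [set` s]); last exact: finite_seq.
by move=> j /=; apply: contraNT => /Xs ->.
Qed.

Lemma dim_trivial (X : vectType R) : (forall x : X, x = 0) -> \dim {: X} = 0%N.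
Proof.
move=> X0; apply/eqP; rewrite dimv_eq0 -subv0; apply/subvP => x _.
by rewrite (X0 x) mem0v.
Qed.

Lemma gsupport_out V j (v : V j) : j \notin gsupport V -> v = 0.
Proof.
rewrite mem_gsupport negbK => /eqP d0; apply/eqP; rewrite -memv0.
have <- : fullv = 0%VS :> {vspace V j} by apply/eqP; rewrite -dimv_eq0 d0.
exact: memvf.
Qed.

Fact gdual_finite V :
  (\esum_(j in [set: int]) (\dim {: 'Hom(V (- j), R^o)})%:R%:E < +oo
    :> \bar R)%E.
Proof.
apply: (@esum_dim_seq (fun j => 'Hom(V (- j), R^o)) (map -%R (gsupport V))).
move=> j js; apply: dim_trivial => f; apply/lfunP => v.
rewrite (@gsupport_out _ _ v) ?linear0 //.
by apply: contra js => js; rewrite -[j]opprK map_f.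
Qed.

Definition gdual V : gradedVect R := GradedVect (gdual_finite V).

Fact gl_finite V :
  (\esum_(k in [set: int]) (\dim {: grHom V V k})%:R%:E < +oo :> \bar R)%E.
Proof.
apply: (@esum_dim_seq (fun k => grHom V V k)
  [seq b - a | a <- gsupport V, b <- gsupport V]) => k ks.
apply: dim_trivial => A; apply: grHomP => j; apply/lfunP => v.
rewrite [RHS]lfunE /=; have [js|js] := boolP (j \in gsupport V); last first.
  by rewrite (@gsupport_out _ _ v) ?linear0.
apply: gsupport_out; apply: contra ks => ks; apply/allpairsP.
by exists (j, j + k); split=> //=; rewrite addrC addKr.
Qed.

Definition gl V : gradedVect R := GradedVect (gl_finite V).

Lemma gcast_hom V W k (A : grHom V W k) i j (e : i = j) (f : i + k = j + k)
    (v : V i) :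
  gcast W f (A i v) = A j (gcast V e v).
Proof. by case: _ / e f => f; rewrite !gcast_id !id_lfunE. Qed.

Fact gcomp_deg (j k l m : int) : k + l = m -> j + l + k = j + m.
Proof. by move=> <-; rewrite -addrA [l + k]addrC. Qed.

(* The degree [m] of the composite is only propositionally [k + l]. *)
Definition gcomp U V W k l m (e : k + l = m)
    (A : grHom V W k) (B : grHom U V l) : grHom U W m :=
  fun j => (gcast W (gcomp_deg j e) \o (A (j + l) \o B j))%VF.

Lemma gcompDl U V W k l m (e : k + l = m) a (A A' : grHom V W k)
    (B : grHom U V l) :
  gcomp e (a *: A + A') B = a *: gcomp e A B + gcomp e A' B.
Proof.
apply: grHomP => j; rewrite grHom_addE grHom_scaleE /gcomp.
by rewrite grHom_addE grHom_scaleE comp_lfunDl comp_lfunDr -comp_lfunZl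
  -comp_lfunZr.
Qed.

Lemma gcompDr U V W k l m (e : k + l = m) a (A : grHom V W k)
    (B B' : grHom U V l) :
  gcomp e A (a *: B + B') = a *: gcomp e A B + gcomp e A B'.
Proof.
apply: grHomP => j; rewrite grHom_addE grHom_scaleE /gcomp.
by rewrite grHom_addE grHom_scaleE !comp_lfunDr -!comp_lfunZr.
Qed.

Definition gbracket V k l (A : gl V k) (B : gl V l) : gl V (k + l) :=
  gcomp erefl A B - (-1) ^ (k * l) *: gcomp (addrC l k) B A.

Section Transpose.
Variables (V : gradedVect R) (k : int).

Fact gtransp_deg (i : int) : - (i + k) + k = - i.
Proof. by rewrite opprD subrK. Qed.

Definition gtransp_comp (A : gl V k) i (xi : gdual V i) : gdual V (i + k) :=
  (-1) ^ (k * i) *: (xi \o (gcast V (gtransp_deg i) \o A (- (i + k))))%VF.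

Fact gtransp_comp_linear A i : linear (@gtransp_comp A i).
Proof.
move=> a x y; rewrite /gtransp_comp comp_lfunDl -comp_lfunZl scalerDr.
by rewrite !scalerA [a * _]mulrC.
Qed.
HB.instance Definition _ A i :=
  GRing.isLinear.Build R _ _ _ (@gtransp_comp A i) (@gtransp_comp_linear A i).

Definition gtransp (A : gl V k) : grHom (gdual V) (gdual V) k :=
  fun i => linfun (@gtransp_comp A i).

Lemma gtranspE A i (xi : gdual V i) (v : V (- (i + k))) :
  gtransp A i xi v =
  (-1) ^ (k * i) * xi (gcast V (gtransp_deg i) (A (- (i + k)) v)).
Proof. by rewrite lfunE /= scale_lfunE !comp_lfunE. Qed.

Fact gtransp_linear : linear gtransp.
Proof.
move=> a A B; apply: grHomP => i; apply/lfunP => xi; apply/lfunP => v.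
rewrite grHom_addE grHom_scaleE !(add_lfunE, scale_lfunE) !gtranspE.
rewrite grHom_addE grHom_scaleE !(add_lfunE, scale_lfunE).
by rewrite !linearP mulrDr; congr (_ + _); apply: mulrCA.
Qed.

End Transpose.

Section Flat.
Variables (V : gradedVect R) (l : int).
Variable b : forall i j, {bilinear V i -> V j -> R | *%R & *%R}.

Definition flat_val i (v : V i) (w : V (- (i + l))) : R^o :=
  (-1) ^ ((i + 1) * l) * b i _ v w.

Fact flat_val_linear i v : linear (@flat_val i v).
Proof. by move=> a x y; rewrite /flat_val linearPr mulrDr mulrCA. Qed.
HB.instance Definition _ i v :=
  GRing.isLinear.Build R _ _ _ (@flat_val i v) (@flat_val_linear i v).

Definition flat_comp i (v : V i) : gdual V (i + l) := linfun (flat_val v).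

Fact flat_comp_linear i : linear (@flat_comp i).
Proof.
move=> a x y; apply/lfunP => w; rewrite add_lfunE.
rewrite -[(a *: flat_comp x) w]/((a *: linfun (flat_val x)) w) scale_lfunE.
rewrite !lfunE /= /flat_val linearPl mulrDr; congr (_ + _); exact: mulrCA.
Qed.
HB.instance Definition _ i :=
  GRing.isLinear.Build R _ _ _ (@flat_comp i) (@flat_comp_linear i).

Definition flat : grHom V (gdual V) l := fun i => linfun (@flat_comp i).

Lemma flatE i (v : V i) (w : V (- (i + l))) :
  flat i v w = (-1) ^ ((i + 1) * l) * b i _ v w.
Proof. by rewrite !lfunE. Qed.

End Flat.

Record metric V (l : int) := Metric {
  metric_form :> forall i j, {bilinear V i -> V j -> R | *%R & *%R};
  metric_deg : forall i j (v : V i) (w : V j),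
    i + j + l != 0 -> metric_form i j v w = 0;
  metric_sym : forall i j (v : V i) (w : V j),
    metric_form i j v w = (-1) ^ ((i + l) * (j + l)) * metric_form j i w v;
  metric_iso : forall i, bijective (flat l metric_form i) }.

Section Metric.
Variables (V : gradedVect R) (l : int) (g : metric V l).

Fact flat_inv_deg (i : int) : i = i - l + l.
Proof. by rewrite subrK. Qed.

Definition flat_inv : grHom (gdual V) V (- l) := fun i =>
  ((flat l g (i - l))^-1 \o gcast (gdual V) (flat_inv_deg i))%VF.

Lemma flat_inj i : injective (flat l g i).
Proof. exact: bij_inj (metric_iso g i). Qed.

Lemma flatK i : cancel (flat l g i) (flat l g i)^-1%VF.
Proof.
by apply: lker0_lfunK; apply/lker0P/flat_inj.
Qed.

Lemma flat_invK i : cancel (flat l g i)^-1%VF (flat l g i).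
Proof.
have [h _ hK] := metric_iso g i.
by move=> x; rewrite -[x]hK flatK.
Qed.

Lemma gcomp_flat_inv :
  gcomp (addNr l) flat_inv (flat l g) = fun j => gcast V (esym (addr0 j)).
Proof.
apply: grHomP => j; apply/lfunP => v; rewrite /gcomp /flat_inv !comp_lfunE.
have e : j = j + l - l by rewrite addrK.
by rewrite (gcast_hom (flat l g) e) flatK -comp_lfunE gcast_comp
  (eq_irrelevance (etrans _ _) (esym (addr0 j))).
Qed.

Lemma gcomp_inv_flat :
  gcomp (subrr l) (flat l g) flat_inv =
  fun j => gcast (gdual V) (esym (addr0 j)).
Proof.
apply: grHomP => j; apply/lfunP => v; rewrite /gcomp /flat_inv !comp_lfunE.
by rewrite flat_invK -comp_lfunE gcast_comp
  (eq_irrelevance (etrans _ _) (esym (addr0 j))).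
Qed.

Section Degree.
Variable k : int.

Fact tau_deg : - l + (k + l) = k.
Proof. by rewrite addrC addrK. Qed.

Definition tau_map (A : gl V k) : gl V k :=
  (-1) ^ (l * k) *: gcomp tau_deg flat_inv (gcomp erefl (gtransp A) (flat l g)).

(* Vanishes iff g A = c (-1)^(l |A|) A^T g; see [mem_gsym], [mem_gskew]. *)
Definition defect (c : R) (A : gl V k) : grHom V (gdual V) (k + l) :=
  gcomp (addrC l k) (flat l g) A
  - (c * (-1) ^ (l * k)) *: gcomp erefl (gtransp A) (flat l g).

Fact tau_map_linear : linear tau_map.
Proof.
move=> a A B; rewrite /tau_map gtransp_linear gcompDl gcompDr scalerDr.
by rewrite !scalerA [a * _]mulrC.
Qed.
HB.instance Definition _ := GRing.isLinear.Build R _ _ _ tau_map tau_map_linear.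

Fact defect_linear c : linear (defect c).
Proof.
move=> a A B; rewrite /defect gtransp_linear gcompDl gcompDr scalerDr scalerBr.
by rewrite !scalerA [_ * a]mulrC opprD addrACA.
Qed.
HB.instance Definition _ c :=
  GRing.isLinear.Build R _ _ _ (defect c) (defect_linear c).

Definition tau : 'End(gl V k) := linfun tau_map.
Definition gsym : {vspace gl V k} := lker (linfun (defect 1)).
Definition gskew : {vspace gl V k} := lker (linfun (defect (-1))).

End Degree.

Lemma tauE k (A : gl V k) :
  tau k A = (-1) ^ (l * k) *:
    gcomp (tau_deg k) flat_inv (gcomp erefl (gtransp A) (flat l g)).
Proof. exact: lfunE. Qed.

Lemma mem_gsym k (A : gl V k) :
  A \in gsym k <->
  gcomp (addrC l k) (flat l g) A =
  (-1) ^ (l * k) *: gcomp erefl (gtransp A) (flat l g).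
Proof.
rewrite memv_ker lfunE /= /defect mul1r subr_eq0.
by split=> /eqP.
Qed.

Lemma mem_gskew k (A : gl V k) :
  A \in gskew k <->
  gcomp (addrC l k) (flat l g) A =
  - ((-1) ^ (l * k) *: gcomp erefl (gtransp A) (flat l g)).
Proof.
rewrite memv_ker lfunE /= /defect mulN1r scaleNr subr_eq0.
by split=> /eqP.
Qed.

End Metric.

Definition graded_subspace V := forall k : int, {vspace V k}.

Definition graded_direct_sum V (S T : graded_subspace V) :=
  forall k, directv (S k + T k) /\ (S k + T k)%VS = fullv.

Definition graded_Lie_subalgebra V (S : graded_subspace (gl V)) :=
  forall k l (A : gl V k) (B : gl V l),
    A \in S k -> B \in S l -> gbracket A B \in S (k + l).

End GradedMaps.

(* Main.v *)
(* Evaluated through the metric, the map tau becomes the adjunction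
   <tau(A) v, w> = (-1)^(|A| (|v| + l)) <v, A w>,
   in which all powers of g and all sign conventions for the transpose have
   disappeared.  The graded symmetry of the metric then gives tau^2 = 1, and
   Sym(V, g) and o(V, g) are the eigenspaces of tau for 1 and -1, which yields
   (i) and (iii); (ii) is two applications of the adjunction formula. *)

Require Import Defs.
From mathcomp Require Import all_boot all_order all_algebra.
From mathcomp Require Import sesquilinear.
From mathcomp Require Import reals.
From mathcomp Require Import ring.

Set Implicit Arguments.
Unset Strict Implicit.
Unset Printing Implicit Defensive.

Import GRing.Theory.
Local Open Scope ring_scope.

(** * Signs with integer exponents *)

Section Signs.
Context {F : fieldType}.
Implicit Types a b c : int.

Lemma signzD a b : (-1 : F) ^ (a + b) = (-1) ^ a * (-1) ^ b.
Proof. by rewrite expfzDr // oppr_eq0 oner_eq0. Qed.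

Lemma signzz a : (-1 : F) ^ a * (-1) ^ a = 1.
Proof. by rewrite -exprzMl ?unitrN1 // mulrNN mulr1 exp1rz. Qed.

(** Exponents matter only modulo 2; [c] is half the difference, so every sign check below is an
    integer identity left to [ring]. *)
Lemma signz_congr a b c : a = b + (c + c) -> (-1 : F) ^ a = (-1) ^ b.
Proof. by move=> ->; rewrite !signzD signzz mulr1. Qed.

Lemma signz_eq0 a : ((-1 : F) ^ a == 0) = false.
Proof. by rewrite expfz_eq0 oppr_eq0 oner_eq0 andbF. Qed.

End Signs.

(** * Casts, [flat], its inverse and transposes evaluated through the form *)

Section MetricForm.
Context {R : realType} {V : gradedVect R} {l : int} {g : metric V l}.

(** The cast changes direction because the dual reverses degrees. [e'] is a separate argument so
    that any proof of that equality can be used. *)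
Lemma gdual_castE i j (e : i = j) (e' : - j = - i) (xi : gdual V i)
    (w : V (- j)) :
  (gcast (gdual V) e xi : 'Hom(_, _)) w = (xi : 'Hom(_, _)) (gcast V e' w).
Proof. by case: _ / e e' w => e' w; rewrite !gcast_id !id_lfunE. Qed.

Lemma metric_castl i i' j (e : i = i') (v : V i) (w : V j) :
  g i' j (gcast V e v) w = g i j v w.
Proof. by case: _ / e; rewrite gcast_id id_lfunE. Qed.

Lemma metric_castr i j j' (e : j = j') (v : V i) (w : V j) :
  g i j' v (gcast V e w) = g i j v w.
Proof. by case: _ / e; rewrite gcast_id id_lfunE. Qed.

Lemma metric_nondeg i (v : V i) :
  (forall j (w : V j), g i j v w = 0) -> v = 0.
Proof.
move=> v0; apply: (@flat_inj _ _ _ g i); rewrite linear0; apply/lfunP => w.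
by rewrite flatE v0 mulr0 lfunE.
Qed.

Lemma flat_transpE k (A : gl V k) i (v : V i) (w : V (- (i + (k + l)))) :
  (gcomp erefl (gtransp A) (flat l g) i v : 'Hom(_, _)) w =
  (-1) ^ (k * (i + l) + (i + 1) * l) * g i _ v (A _ w).
Proof.
rewrite /gcomp !comp_lfunE /=.
have e' : - (i + (k + l)) = - (i + l + k) by rewrite -addrA [k + l]addrC.
rewrite (gdual_castE _ e') gtranspE flatE mulrA -signzD metric_castr.
have e'' : - (i + (k + l)) + k = - (i + l + k) + k by rewrite e'.
by rewrite -(@gcast_hom _ V V k A _ _ e' e'') metric_castr.
Qed.

Lemma flat_compE k (A : gl V k) i (v : V i) (w : V (- (i + (k + l)))) :
  (gcomp (addrC l k) (flat l g) A i v : 'Hom(_, _)) w =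
  (-1) ^ ((i + k + 1) * l) * g _ _ (A i v) w.
Proof.
rewrite /gcomp !comp_lfunE /=.
have e' : - (i + (k + l)) = - (i + k + l) by rewrite addrA.
by rewrite (gdual_castE _ e') flatE metric_castr.
Qed.

Lemma gdual_scaleE k (a : R) (X : grHom V (gdual V) k) i (v : V i)
    (w : V (- (i + k))) :
  ((a *: X) i v : 'Hom(_, _)) w = a * (X i v : 'Hom(_, _)) w.
Proof. by rewrite grHom_scaleE scale_lfunE [LHS]scale_lfunE. Qed.

Lemma int_opp_eq (a b : int) : a + b = 0 -> b = - a.
Proof. by move=> ab; apply/eqP; rewrite -addr_eq0 addrC ab. Qed.

(** In the complementary degree the two sides of the defining equation carry the common sign
    [(-1) ^ ((i + k + 1) * l)], which cancels; in any other degree both values of the form are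
    zero. *)
Lemma defect_eq0P k (c : R) (A : gl V k) :
  defect g c A = 0 <->
  forall i j (v : V i) (w : V j),
    g _ _ (A i v) w = c * (-1) ^ (k * (i + l)) * g _ _ v (A j w).
Proof.
have main i (v : V i) (w : V (- (i + (k + l)))) :
    (gcomp (addrC l k) (flat l g) A i v : 'Hom(_, _)) w =
    (((c * (-1) ^ (l * k)) *: gcomp erefl (gtransp A) (flat l g)) i v
       : 'Hom(_, _)) w <->
    g _ _ (A i v) w = c * (-1) ^ (k * (i + l)) * g _ _ v (A _ w).
  rewrite gdual_scaleE flat_compE flat_transpE.
  set x := g _ _ _ _; set y := g _ _ _ _.
  rewrite [X in _ = X <-> _](_ : _ =
    (-1) ^ ((i + k + 1) * l) * (c * (-1) ^ (k * (i + l)) * y)); last first.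
    rewrite !mulrA [_ * c]mulrC -!mulrA; congr (_ * _).
    rewrite !mulrA -!signzD; congr (_ * _).
    by apply: (@signz_congr _ _ _ 0); ring.
  by split=> [/mulfI->//|->//]; rewrite signz_eq0.
rewrite /defect; split=> [/subr0_eq A0 i j v w|gA]; last first.
  apply/eqP; rewrite subr_eq0; apply/eqP; apply: grHomP => i.
  by apply/lfunP => v; apply/lfunP => w; apply/main.
have [/eqP d|d] := boolP (i + j + k + l == 0); last first.
  rewrite !metric_deg ?mulr0 //; first by rewrite addrA.
  by rewrite [i + k + j]addrAC.
have e : j = - (i + (k + l)) by apply: int_opp_eq; rewrite -d; ring.
move: v w; rewrite e => v w.
by apply/main; rewrite A0.
Qed.

(** The sign is that of [flat] in degree [i - l], moved across the equation, since signs are their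
    own inverses. *)
Lemma flat_inv_form i (xi : gdual V i) (w : V (- i)) :
  g _ _ (flat_inv g i xi) w = (-1) ^ ((i + 1) * l) * (-1) ^ (l * l) *
    (xi : 'Hom(_, _)) w.
Proof.
have e : - i = - (i - l + l) by rewrite subrK.
rewrite -(metric_castr e) /flat_inv comp_lfunE.
set u := (_^-1)%VF _.
have <- : (flat l g _ u : 'Hom(_, _)) (gcast V e w) = (xi : 'Hom(_, _)) w.
  rewrite flat_invK (gdual_castE _ (esym e)) -comp_lfunE gcast_comp gcast_id.
  by rewrite id_lfunE.
rewrite flatE !mulrA -!signzD (@signz_congr _ _ 0 ((i + 1) * l)) ?mul1r //.
ring.
Qed.

Lemma tau_form k (A : gl V k) i j (v : V i) (w : V j) :
  g _ _ (tau g k A i v) w = (-1) ^ (k * (i + l)) * g _ _ v (A j w).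
Proof.
have [/eqP d|d] := boolP (i + j + k + l == 0); last first.
  rewrite !metric_deg ?mulr0 //; first by rewrite addrA.
  by rewrite [i + k + j]addrAC.
have e : j = - (i + (k + l)) by apply: int_opp_eq; rewrite -d; ring.
move: v w; rewrite e => v w.
rewrite tauE grHom_scaleE scale_lfunE linearZl_LR /= {1}/gcomp comp_lfunE.
rewrite metric_castl [X in g _ _ X _]comp_lfunE flat_inv_form flat_transpE.
rewrite !mulrA -!signzD.
(* The exponents [l * k], [(i + 1) * l] and [l * l] each occur twice; what survives is the
   [k * (i + l)] of the transpose. *)
congr (_ * _); apply: (@signz_congr _ _ _ (l * k + (i + 1) * l + l * l)); ring.
Qed.

(** * Eigenspaces of the involution [tau] *)

Lemma metric_ext k (A B : gl V k) :
  (forall i j (v : V i) (w : V j), g _ _ (A i v) w = g _ _ (B i v) w) -> A = B.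
Proof.
move=> AB; apply: grHomP => i; apply/lfunP => v.
apply/eqP; rewrite -subr_eq0; apply/eqP/metric_nondeg => j w.
by rewrite linearBl /= AB subrr.
Qed.

(** Under the form both sides become the same adjunction relation; [c = 1] and [c = -1] give the two
    eigenspaces. *)
Lemma defect_tau k (c : R) (A : gl V k) :
  defect g c A = 0 <-> A = c *: tau g k A.
Proof.
split=> [/defect_eq0P gA|At].
  apply: metric_ext => i j v w.
  by rewrite gA grHom_scaleE scale_lfunE linearZl_LR /= tau_form mulrA.
apply/defect_eq0P => i j v w.
by rewrite {1}At grHom_scaleE scale_lfunE linearZl_LR /= tau_form mulrA.
Qed.

Lemma gsym_tau k (A : gl V k) : A \in gsym g k <-> tau g k A = A.
Proof.
rewrite memv_ker lfunE /=; split=> [/eqP/defect_tau|At].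
  by rewrite scale1r.
by apply/eqP/defect_tau; rewrite scale1r.
Qed.

Lemma gskew_tau k (A : gl V k) : A \in gskew g k <-> tau g k A = - A.
Proof.
rewrite memv_ker lfunE /=; split=> [/eqP/defect_tau|At].
  by rewrite scaleN1r => {2}->; rewrite opprK.
by apply/eqP/defect_tau; rewrite scaleN1r At opprK.
Qed.

Lemma gskewP k (A : gl V k) : A \in gskew g k <->
  forall i j (v : V i) (w : V j),
    g _ _ (A i v) w = - (-1) ^ (k * (i + l)) * g _ _ v (A j w).
Proof.
rewrite memv_ker lfunE /=; split=> [/eqP/defect_eq0P gA|gA] *.
  by rewrite gA mulN1r.
by apply/eqP/defect_eq0P => *; rewrite mulN1r.
Qed.

(** Two adjunctions, with the arguments swapped before and after the second; the exponents
    [k * (i + l)], [k * (j + l)] and [(i + l) * (j + l)] all occur twice. *)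
Lemma tauK k (A : gl V k) : tau g k (tau g k A) = A.
Proof.
apply: metric_ext => i j v w.
rewrite tau_form metric_sym tau_form [g _ _ w _]metric_sym !mulrA -!signzD.
rewrite (@signz_congr _ _ 0
  (k * (i + l) + (i + l) * (j + l) + k * (j + l))) ?mul1r //; ring.
Qed.

(** * Closure under the graded commutator *)

Lemma gcomp_form k m n (e : k + m = n) (A : gl V k) (B : gl V m) i j
    (v : V i) (w : V j) :
  g _ _ (gcomp e A B i v) w = g _ _ (A _ (B i v)) w.
Proof. by rewrite /gcomp !comp_lfunE metric_castl. Qed.

Lemma gcomp_formr k m n (e : k + m = n) (A : gl V k) (B : gl V m) i j
    (v : V i) (w : V j) :
  g _ _ v (gcomp e A B j w) = g _ _ v (A _ (B j w)).
Proof. by rewrite /gcomp !comp_lfunE metric_castr. Qed.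

(** Moving both maps across the form cancels their two minus signs and reverses their order; the
    remaining minus comes from exchanging the two terms of the commutator. *)
Lemma gskew_Lie : graded_Lie_subalgebra (gskew g).
Proof.
move=> k m A B /gskewP gA /gskewP gB; apply/gskewP => i j v w.
rewrite /gbracket !grHom_addE !grHom_oppE !grHom_scaleE !add_lfunE !opp_lfunE.
rewrite !scale_lfunE linearBl linearBr linearZl_LR linearZr_LR /=.
rewrite !gcomp_form !gcomp_formr gA gB gB gA !mulrBr.
rewrite !(mulNr, mulrN, opprK) !mulrA -!signzD [LHS]addrC.
congr (- (_ * _) + _ * _).
  apply: (@signz_congr _ _ _ (k * m)); ring.
apply: (@signz_congr _ _ _ 0); ring.
Qed.

(** * The direct sum decomposition *)

Lemma gsym_gskew_sum : graded_direct_sum (gsym g) (gskew g).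
Proof.
have two_unit : (2 : R) != 0 by rewrite Num.Theory.pnatr_eq0.
move=> k; split.
  apply/directv_addP/eqP; rewrite -subv0; apply/subvP => A.
  rewrite memv_cap memv0 => /andP[/gsym_tau As /gskew_tau].
  (* A map in both subspaces satisfies [A = - A], hence [2 *: A = 0]. *)
  rewrite As => /eqP; rewrite -subr_eq0 opprK -mulr2n -scaler_nat scaler_eq0.
  by rewrite (negPf two_unit).
apply/eqP; rewrite eqEsubv subvf; apply/subvP => A _.
have -> : A = 2^-1 *: (A + tau g k A) + 2^-1 *: (A - tau g k A).
  by rewrite -scalerDr addrACA subrr addr0 -mulr2n -scaler_nat scalerA mulVf
    ?scale1r.
apply: memv_add; rewrite memvZ //.
  by apply/gsym_tau; rewrite linearD /= tauK addrC.
by apply/gskew_tau; rewrite linearB /= tauK opprB.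
Qed.

End MetricForm.

Theorem proposition1p5 (R : realType) (V : gradedVect R) (l : int)
    (g : metric V l) :
  [/\ graded_direct_sum (gsym g) (gskew g),
      graded_Lie_subalgebra (gskew g)
    & forall k : int,
        daddv_pi (gskew g k) (gsym g k) = 2^-1 *: (\1%VF - tau g k)].
Proof.
split; [exact: gsym_gskew_sum | exact: gskew_Lie |].
move=> k; have [/directv_addP dir tot] := gsym_gskew_sum (g := g) k.
apply/lfunP => A.
have : A \in (gsym g k + gskew g k)%VS by rewrite tot memvf.
case/memv_addP => S Ss [T Tk ->].
have [/gsym_tau St /gskew_tau Tt] := (Ss, Tk).
rewrite capvC in dir.
have piT : daddv_pi (gskew g k) (gsym g k) T = T by exact: daddv_pi_id.
(* The two complementary projections of [S] add up to [S], and the one onto [gsym g k] already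
   returns [S]. *)
have piS : daddv_pi (gskew g k) (gsym g k) S = 0.
  have := daddv_pi_add dir (subvP (addvSr _ _) _ Ss).
  rewrite [X in _ + X]daddv_pi_id 1?capvC // => /(canRL (addrK _)).
  by rewrite subrr.
have tauST : tau g k (S + T) = S - T.
  by rewrite -Tt -[S in RHS]St; exact: linearD.
(* It remains to see that half of [(S + T) - (S - T)] is [T]. *)
rewrite linearD /= piS piT add0r scale_lfunE add_lfunE opp_lfunE id_lfunE.
rewrite tauST opprB addrC addrA subrK.
rewrite -mulr2n -scaler_nat scalerA mulVf ?scale1r //.
by rewrite Num.Theory.pnatr_eq0.
Qed.
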